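(* Let $m,n\ge1$ and $a,b\ge0$ be given integers. Then $G^-_{d,m,a,b}(n)$, as a function of the positive integer $d$, is a polynomial in $d$ of degree $2a+b+\lfloor\frac{n+1}{2}\rfloor$.
   Context: For integers $d\ge1$, $n\ge0$ let $\mathcal{A}_{d,n}=\{(i,j):1\le i\le d,\ 1\le j\le n\}$. A subset $I\subseteq\mathcal{A}_{d,n}$ is nice if (1) $(i+1,j)\in I$ with $i\ge1$ implies $(i,j)\in I$, and (2) $(1,j)\in I$ with $1\le j\le n-1$ implies $(1,j+1)\notin I$. $\mathcal{B}^-_{d,n}$ is the set of nice subsets $I$ of $\mathcal{A}_{d,n}$ with $(d,n)\notin I$. For $I$ nice, $|I|$ is its cardinality and $\sigma_m(I)=\sum_{(i,j)\in I}((i-1)m+j)$. Define $G^-_{d,m,a,b}(n)=\sum_{I\in\mathcal{B}^-_{d,n}}\sigma_m(I)^a|I|^b$ (with $0^0=1$). *)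

(* Defs.v *)
From mathcomp Require Import all_boot all_order all_algebra.

Set Implicit Arguments.
Unset Strict Implicit.
Unset Printing Implicit Defensive.

(* The pair (i, j) : 'I_d * 'I_n stands for the cell (i + 1, j + 1) of         *)
(* A_{d,n}: ordinals count from 0, rows and columns of A_{d,n} from 1.         *)
Definition cell (d n : nat) : finType := ('I_d * 'I_n)%type.

Definition nice (d n : nat) (I : {set cell d n}) : bool :=
  [forall i : 'I_d, forall i' : 'I_d, forall j : 'I_n,
     (i' == i.+1 :> nat) && ((i', j) \in I) ==> ((i, j) \in I)]
  && [forall i : 'I_d, forall j : 'I_n, forall j' : 'I_n,
     [&& i == 0 :> nat, j' == j.+1 :> nat & (i, j) \in I]
       ==> ((i, j') \notin I)].

(* Membership of the corner cell (d, n) is tested on coordinates because       *)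
(* 'I_d * 'I_n has no such element when d = 0 or n = 0.                        *)
Definition Bminus (d n : nat) : {set {set cell d n}} :=
  [set I : {set cell d n} | nice I &
     [forall x in I, ~~ ((x.1.+1 == d) && (x.2.+1 == n))]].

(* The summand (i - 1) m + j, in the 0-based coordinates of cell.              *)
Definition sigma (m d n : nat) (I : {set cell d n}) : nat :=
  \sum_(x in I) (x.1 * m + x.2.+1).

Definition Gminus (d m a b n : nat) : nat :=
  \sum_(I in Bminus d n) sigma m I ^ a * #|I| ^ b.

(* Main.v *)
(** A nice set is determined by its column heights h_1, ..., h_n <= d, subject to
    no two adjacent heights being nonzero and h_n < d.  Group the height vectors by
    support S and expand both powers, so that G(d) becomes a finite sum, over S and
    over maps {1..a}, {1..b} -> {1..n}, of products over the columns j of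
    sum_c q_j(c)^alpha * c^beta, where q_j is quadratic with leading coefficient
    m/2 > 0.  Each factor with j in S is a polynomial in d of degree
    2 alpha + beta + 1 with positive leading coefficient; the other factors are
    constants >= 0.  Hence each product has degree at most 2a + b + |S|, leading
    coefficients cannot cancel, and the largest |S|, namely ceil(n/2), is attained
    by taking every other column. *)

Require Import Defs.
From mathcomp Require Import all_boot all_order all_algebra zify.

Set Implicit Arguments.
Unset Strict Implicit.
Unset Printing Implicit Defensive.
Import Order.TTheory GRing.Theory Num.Theory.

Local Open Scope ring_scope.

(** * Polynomial growth and its closure under sums and products *)

(* The coefficient at [N] is nonnegative, and nonzero when [s] holds: these two
   facts are stable under sums and products, so no cancellation can occur. *)
Definition polygrowth (s : bool) (N : nat) (f : nat -> nat) : Prop :=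
  exists p : {poly rat},
    [/\ (size p <= N.+1)%N, 0 <= p`_N, s ==> (p`_N != 0)
      & forall d, (f d)%:R = p.[d%:R]].

Lemma eq_polygrowth s N f g :
  f =1 g -> polygrowth s N f -> polygrowth s N g.
Proof.
by move=> fg [p [? ? ? fp]]; exists p; split=> // d; rewrite -fg.
Qed.

(** Above the old bound the coefficient is 0: still nonnegative, but known to be nonzero only if the
    index does not move. *)
Lemma polygrowth_weaken (s t : bool) N M f :
  (N <= M)%N -> (t -> s && (N == M)) -> polygrowth s N f -> polygrowth t M f.
Proof.
move=> leNM st [p [sz ge0 ne0 fp]]; exists p; split=> //.
- exact: leq_trans sz _.
- case: (ltngtP N M) leNM => // [ltNM|<-] _ //.
  by rewrite nth_default // (leq_trans sz).
- by apply/implyP=> /st /andP[s1 /eqP<-]; rewrite s1 in ne0.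
Qed.

Lemma polygrowth_const c : polygrowth (c != 0%N) 0 (fun=> c).
Proof.
exists (c%:R)%:P; split=> [||| d]; rewrite ?coefC ?size_polyC_leq1 ?ler0n ?hornerC //=.
by rewrite pnatr_eq0 implybb.
Qed.

Lemma polygrowth_id : polygrowth true 1 id.
Proof. by exists 'X; split=> [||| d]; rewrite ?size_polyX ?coefX ?hornerX. Qed.

Lemma polygrowthD s t N f g : polygrowth s N f -> polygrowth t N g ->
  polygrowth (s || t) N (fun d => f d + g d)%N.
Proof.
move=> [p [szp p0 sp fp]] [q [szq q0 sq gq]]; exists (p + q); split.
- by rewrite (leq_trans (size_polyD _ _)) // geq_max szp.
- by rewrite coefD addr_ge0.
- rewrite coefD paddr_eq0 // negb_and; apply/implyP=> /orP[s1|t1].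
  + by rewrite (implyP sp).
  + by rewrite (implyP sq) ?orbT.
- by move=> d; rewrite natrD hornerD fp gq.
Qed.

(** In the convolution at [M + N], every pair of indices other than [(M, N)] has one entry beyond
    its size bound. *)
Lemma coefM_top (R : nzRingType) (p q : {poly R}) M N :
  (size p <= M.+1)%N -> (size q <= N.+1)%N -> (p * q)`_(M + N) = p`_M * q`_N.
Proof.
move=> szp szq; have ltM : (M < (M + N).+1)%N by rewrite ltnS leq_addr.
rewrite coefM (bigD1 (Ordinal ltM)) //= addKn big1 ?addr0 // => i.
rewrite -val_eqE /=; case: ltngtP => // [ltiM|ltMi] _.
- rewrite [q`__]nth_default ?mulr0 // (leq_trans szq) //.
  by rewrite ltn_subRL ltn_add2r.
- by rewrite [p`__]nth_default ?mul0r // (leq_trans szp).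
Qed.

Lemma polygrowthM s t M N f g : polygrowth s M f -> polygrowth t N g ->
  polygrowth (s && t) (M + N) (fun d => f d * g d)%N.
Proof.
move=> [p [szp p0 sp fp]] [q [szq q0 sq gq]]; exists (p * q); split.
- rewrite (leq_trans (size_polyMleq _ _)) // -subn1 leq_subLR.
  by rewrite (leq_trans (leq_add szp szq)) // addSn addnS.
- by rewrite coefM_top // mulr_ge0.
- rewrite coefM_top // mulf_eq0 negb_or; apply/implyP=> /andP[s1 t1].
  by rewrite (implyP sp) ?(implyP sq).
- by move=> d; rewrite natrM hornerM fp gq.
Qed.

Lemma polygrowthX s N f k : polygrowth s N f ->
  polygrowth (s || (k == 0)%N) (N * k) (fun d => f d ^ k)%N.
Proof.
move=> gf; elim: k => [|k IH]; first by rewrite orbT muln0; apply: polygrowth_const 1%N.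
rewrite mulnS; apply: (eq_polygrowth (f := fun d => f d * f d ^ k)%N).
  by move=> d; rewrite expnS.
apply: polygrowth_weaken (polygrowthM gf IH) => //.
by rewrite orbF => ->; rewrite eqxx.
Qed.

Lemma polygrowth_sum (I : finType) (P : pred I) (s : pred I) N f :
    (forall i, P i -> polygrowth (s i) N (f i)) ->
  polygrowth [exists (i | P i), s i] N (fun d => \sum_(i | P i) f i d)%N.
Proof.
move=> gf; rewrite -big_orE.
elim: (index_enum I) => [|i r IH].
  rewrite big_nil; apply: (eq_polygrowth (f := fun=> 0%N)).
    by move=> d; rewrite big_nil.
  exact: polygrowth_weaken (polygrowth_const 0).
rewrite big_cons; case: ifP => Pi.
  apply: eq_polygrowth (polygrowthD (gf i Pi) IH) => d.
  by rewrite big_cons Pi.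
by apply: eq_polygrowth IH => d; rewrite big_cons Pi.
Qed.

Lemma polygrowth_prod (I : finType) (s : pred I) N f :
    (forall i, polygrowth (s i) (N i) (f i)) ->
  polygrowth [forall i, s i] (\sum_i N i) (fun d => \prod_i f i d)%N.
Proof.
move=> gf; have -> : [forall i, s i] = \big[andb/true]_i s i by rewrite big_andE.
elim: (index_enum I) => [|i r IH].
  rewrite !big_nil; apply: (eq_polygrowth (f := fun=> 1%N)).
    by move=> d; rewrite big_nil.
  exact: polygrowth_const 1%N.
rewrite !big_cons; apply: eq_polygrowth (polygrowthM (gf i) IH) => d.
by rewrite big_cons.
Qed.

(** * Shifts, antidifferences and summation up to [d] *)

Lemma coef_comp_XaddC_top (R : idomainType) (p : {poly R}) c N :
  (size p <= N.+1)%N -> (p \Po ('X + c%:P))`_N = p`_N.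
Proof.
have sz : size (p \Po ('X + c%:P)) = size p.
  by rewrite size_comp_poly2 // size_XaddC.
rewrite leq_eqVlt => /orP[/eqP szp|]; last first.
  by rewrite ltnS => szp; rewrite !nth_default ?sz.
have := lead_coef_comp p (_ : (1 < size ('X + c%:P)%R)%N).
by rewrite size_XaddC lead_coefXaddC expr1n mulr1 !lead_coefE sz szp => ->.
Qed.

Lemma polygrowthS s N f : polygrowth s N f -> polygrowth s N (f \o S).
Proof.
move=> [p [szp p0 sp fp]]; exists (p \Po ('X + 1%:P)).
rewrite coef_comp_XaddC_top // size_comp_poly2 ?size_XaddC //; split=> // d.
by rewrite horner_comp /= fp !hornerE -natr1.
Qed.

Lemma coef_XaddC1_exp (R : nzRingType) n j :
  (('X + 1%:P : {poly R}) ^+ n)`_j = 'C(n, j)%:R.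
Proof.
elim: n j => [|n IH] [|j]; rewrite ?expr0 ?coef1 ?bin0 //.
  by rewrite exprSr mulrDr mulr1 coefD coefMX IH add0r bin0.
by rewrite exprSr mulrDr mulr1 coefD coefMX !IH binS natrD addrC.
Qed.

(** Induction on the size bound: [('X + 1) ^+ N.+1 - 'X^(N.+1)] has degree [N] and leading
    coefficient [N.+1], so a multiple of it cancels the top term of [q]. *)
Lemma antidifference N (q : {poly rat}) : (size q <= N)%N ->
  exists p : {poly rat}, [/\ (size p <= N.+1)%N, p`_N = q`_N.-1 / N%:R
    & p \Po ('X + 1%:P) - p = q].
Proof.
elim: N q => [|N IH] q szq.
  (* Here [q = 0], and the quotient by [0%:R] is 0 by convention. *)
  exists 0; rewrite size_poly0 coef0 invr0 mulr0 comp_poly0 subr0; split=> //.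
  by apply/esym/eqP; rewrite -size_poly_leq0.
pose c := q`_N / N.+1%:R.
pose r := c *: (('X + 1%:P) ^+ N.+1 - 'X^(N.+1) : {poly rat}).
have szr : (size (q - r)%R <= N)%N.
  apply/leq_sizeP => j leNj; rewrite coefB coefZ coefB coefXn coef_XaddC1_exp.
  case: (ltngtP j N.+1) => [ltj|ltj|->].
  - have -> : j = N by apply/eqP; rewrite eqn_leq leNj andbT -ltnS.
    by rewrite subr0 binSn divfK ?subrr // pnatr_eq0.
  - by rewrite bin_small // subr0 mulr0 subr0 nth_default // (leq_trans szq) // ltnW.
  - by rewrite binn subrr mulr0 subr0 nth_default.
have [p [szp _ Dp]] := IH _ szr.
exists (c *: 'X^(N.+1) + p); split.
- rewrite (leq_trans (size_polyD _ _)) // geq_max (leq_trans szp) // andbT.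
  by rewrite (leq_trans (size_scale_leq _ _)) // size_polyXn.
- by rewrite coefD coefZ coefXn eqxx mulr1 nth_default ?addr0.
rewrite comp_polyD comp_polyZ comp_Xn_poly opprD addrACA Dp -scalerBr -/r.
by rewrite addrC subrK.
Qed.

Lemma polygrowth_sum_ord s N f : polygrowth s N f ->
  polygrowth s N.+1 (fun d => \sum_(i < d) f i)%N.
Proof.
move=> [q [szq q0 sq fq]].
have [p [szp pN Dp]] := antidifference szq.
(* The sum telescopes to [p.[d] - p.[0]]; the constant does not touch the coefficient at [N.+1]. *)
exists (p - (p.[0])%:P); split.
- by rewrite (leq_trans (size_polyD _ _)) // geq_max szp size_polyN (leq_trans (size_polyC_leq1 _)).
- by rewrite coefB coefC subr0 pN divr_ge0.
- by rewrite coefB coefC subr0 pN mulf_eq0 negb_or invr_eq0 pnatr_eq0 andbT.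
elim=> [|d IH]; first by rewrite big_ord0 !hornerE subrr.
rewrite big_ord_recr natrD IH fq -Dp !hornerE horner_comp !hornerE natr1.
by rewrite addrC /= addrAC addrK addrC.
Qed.

(** * Nice sets as vectors of column heights *)

Local Open Scope nat_scope.

Definition col_sigma (m j c : nat) : nat := \sum_(i < c) (i * m + j.+1).

Definition young (d n : nat) (h : {ffun 'I_n -> 'I_d.+1}) : {set cell d n} :=
  [set x : cell d n | x.1 < h x.2].

(** Counting cells makes sense for every set, nice or not; the count is at most [d], so [inord] does
    not truncate. *)
Definition heights (d n : nat) (I : {set cell d n}) : {ffun 'I_n -> 'I_d.+1} :=
  [ffun j => inord #|[set i : 'I_d | (i, j) \in I]|].

Definition separated (n : nat) (S : {set 'I_n}) : bool :=
  [forall j : 'I_n, forall j' : 'I_n,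
     (j' == j.+1 :> nat) && (j \in S) ==> (j' \notin S)].

(* The heights of column [j] when the support is [S]; the last conjunct excludes
   the corner cell. *)
Definition allowed (d n : nat) (S : {set 'I_n}) (j : 'I_n) : pred 'I_d.+1 :=
  fun c => ((c != 0 :> nat) == (j \in S))
           && ~~ ((c == d :> nat) && (j.+1 == n)).

Lemma card_ord_lt d k : k <= d -> #|[set i : 'I_d | i < k]| = k.
Proof.
move=> le_kd; rewrite -sum1_card (eq_bigl (fun i : 'I_d => i < k)).
  by rewrite -(big_ord_widen _ (fun=> 1)) // sum1_card card_ord.
by move=> i; rewrite inE.
Qed.

Lemma youngK d n : cancel (@young d n) (@heights d n).
Proof.
move=> h; apply/ffunP=> j; rewrite ffunE; apply: val_inj => /=.
have -> : [set i : 'I_d | (i, j) \in young h] = [set i : 'I_d | i < h j].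
  by apply/setP=> i; rewrite !inE.
by rewrite card_ord_lt ?inordK // -ltnS.
Qed.

Lemma nice_col_closed d n (I : {set cell d n}) (i i' : 'I_d) j :
  nice I -> i' <= i -> (i, j) \in I -> (i', j) \in I.
Proof.
move=> /andP[/forallP I1 _] le_i'i.
move: {2}(i - i') (erefl (i - i')) => k; elim: k i' le_i'i => [|k IH] i' le_i'i Dk.
  suff -> : i' = i by [].
  by apply/val_inj/eqP; rewrite eqn_leq le_i'i -subn_eq0 Dk.
move=> Iij; have lt_i'i : i' < i by rewrite -subn_gt0 Dk.
have i'S : i'.+1 < d by apply: leq_trans (ltn_ord i).
have /forallP/(_ (Ordinal i'S))/forallP/(_ j)/implyP := I1 i'.
apply; rewrite eqxx /= IH //=.
by rewrite subnS Dk.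
Qed.

(** A downward closed column is an initial segment, hence determined by its cardinality; both
    inclusions compare it with an initial segment ending at or just before [i]. *)
Lemma heightsK d n (I : {set cell d n}) : nice I -> young (heights I) = I.
Proof.
move=> niceI; apply/setP=> -[i j]; rewrite inE ffunE /=.
set C := [set i | _].
have leC : #|C| <= d by rewrite -[X in _ <= X]card_ord max_card.
rewrite inordK ?ltnS //; apply/idP/idP => [ltiC|Iij].
  apply: contraLR ltiC => nIij; rewrite -leqNgt -(card_ord_lt (ltnW (ltn_ord i))).
  apply/subset_leq_card/subsetP=> i'; rewrite !inE => Ii'j.
  by rewrite ltnNge; apply: contra nIij => le_ii'; apply: nice_col_closed Ii'j.
rewrite -(card_ord_lt (ltn_ord i)).
apply/subset_leq_card/subsetP=> i'; rewrite !inE ltnS => le_i'i.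
exact: nice_col_closed Iij.
Qed.

(** Columns of [young h] are closed downwards by construction. As [0 < d], a bottom row exists, and
    a column meets it exactly when its height is nonzero. *)
Lemma young_Bminus d n (h : {ffun 'I_n -> 'I_d.+1}) : 0 < d ->
  (young h \in Bminus d n) =
  separated [set j | h j != 0 :> nat]
    && [forall j : 'I_n, ~~ ((h j == d :> nat) && (j.+1 == n))].
Proof.
move=> d_gt0; rewrite inE; congr andb.
  apply/andP/forallP => [[_ /forallP I2] j|sep].
    apply/forallP=> j'; rewrite !inE.
    have /forallP/(_ j)/forallP/(_ j') := I2 (Ordinal d_gt0).
    by rewrite !inE /= !lt0n.
  split.
    do 3![apply/forallP=> ?]; rewrite !inE /=; apply/implyP=> /andP[/eqP->].
    exact: ltnW.
  apply/forallP=> i; apply/forallP=> j; apply/forallP=> j'; rewrite !inE /=.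
  apply/implyP=> /and3P[/eqP-> Dj' h_gt0].
  have /forallP/(_ j') := sep j; rewrite !inE Dj' -lt0n h_gt0 /= negbK.
  by move/eqP->.
apply/forallP/forallP => [corner j|top [i j]].
  apply/negP=> /andP[/eqP hj jn].
  (* A last column of full height [d] contains the corner, whose 0-based row is [d.-1]. *)
  have ltd : d.-1 < d by rewrite prednK.
  have := corner (Ordinal ltd, j).
  by rewrite !inE /= hj prednK // leqnn eqxx jn.
rewrite inE /=; apply/implyP=> lt_ih; apply: contra (top j) => /andP[/eqP Di ->].
by rewrite andbT eqn_leq -ltnS ltn_ord -{1}Di.
Qed.

(** Once the support is fixed, the remaining conditions concern each column separately, so the
    heights range over a [family], to which distributivity applies. *)
Lemma sum_Bminus d n (F : {set cell d n} -> nat) : 0 < d ->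
  \sum_(I in Bminus d n) F I =
  \sum_(S : {set 'I_n} | separated S) \sum_(h in family (@allowed d n S)) F (young h).
Proof.
move=> d_gt0; rewrite (reindex_onto (@young d n) (@heights d n)); last first.
  by move=> I; rewrite inE => /andP[/heightsK].
rewrite (partition_big (fun h : {ffun 'I_n -> 'I_d.+1} => [set j | h j != 0 :> nat]) (@separated n)); last first.
  by move=> h /andP[]; rewrite young_Bminus // => /andP[].
apply: eq_bigr => S sepS; apply: eq_bigl => h.
rewrite youngK eqxx andbT young_Bminus //.
apply/andP/familyP => [[/andP[_ /forallP top] /eqP DS] j|fam].
  by apply/andP; split; [rewrite -DS inE | exact: top].
have DS : [set j | h j != 0 :> nat] = S.
  by apply/setP=> j; rewrite inE; have /andP[/eqP] := fam j.
rewrite DS sepS eqxx; split=> //=; apply/forallP=> j.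
by have /andP[] := fam j.
Qed.

(** * Column sums and expansion of the two powers *)

Lemma sum_young d n (h : {ffun 'I_n -> 'I_d.+1}) (F : nat -> nat -> nat) :
  \sum_(x in young h) F x.1 x.2 = \sum_j \sum_(i < h j) F i j.
Proof.
rewrite (eq_bigl (fun x : cell d n => true && (x.1 < h x.2))); last first.
  by move=> x; rewrite inE.
rewrite -(pair_big_dep xpredT (fun (i : 'I_d) (j : 'I_n) => i < h j) (fun i j => F (val i) (val j))) /=.
rewrite (exchange_big_dep xpredT) //=; apply: eq_bigr => j _.
by rewrite (big_ord_widen d (fun i => F i j)) // -ltnS.
Qed.

Lemma sigma_young m d n (h : {ffun 'I_n -> 'I_d.+1}) :
  sigma m (young h) = \sum_(j < n) col_sigma m j (h j).
Proof. exact: (sum_young h (fun i j => i * m + j.+1)). Qed.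

Lemma card_young d n (h : {ffun 'I_n -> 'I_d.+1}) : #|young h| = \sum_(j < n) h j.
Proof.
rewrite -sum1_card (sum_young h (fun _ _ => 1)).
by apply: eq_bigr => j _; rewrite sum1_card card_ord.
Qed.

(** A multinomial expansion indexed by maps, with factors grouped by fibre so that each term is a
    product over columns. *)
Lemma expn_sum n a (u : 'I_n -> nat) :
  (\sum_j u j) ^ a =
  \sum_(f : {ffun 'I_a -> 'I_n}) \prod_j u j ^ #|[pred t | f t == j]|.
Proof.
rewrite -[a in LHS]card_ord -prod_nat_const bigA_distr_bigA /=.
apply: eq_bigr => f _; rewrite (partition_big f xpredT) //=.
apply: eq_bigr => j _; rewrite -prod_nat_const.
by apply: eq_big => t // /eqP->.
Qed.

Lemma Gminus_expand d m a b n :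
  Gminus d.+1 m a b n =
  \sum_(S : {set 'I_n} | separated S)
    \sum_(fg : {ffun 'I_a -> 'I_n} * {ffun 'I_b -> 'I_n})
      \prod_(j < n) \sum_(c : 'I_d.+2 | allowed S j c)
        col_sigma m j c ^ #|[pred t | fg.1 t == j]| * c ^ #|[pred t | fg.2 t == j]|.
Proof.
rewrite /Gminus sum_Bminus //; apply: eq_bigr => S _.
under [RHS]eq_bigr do rewrite bigA_distr_big_dep.
rewrite exchange_big; apply: eq_bigr => h _ /=.
rewrite sigma_young card_young !expn_sum big_distrlr pair_big /=.
by apply: eq_bigr => fg _; rewrite -big_split.
Qed.

(** * Growth of the factor of one column *)

Lemma polygrowth_col_sigma m j : 0 < m -> polygrowth true 2 (col_sigma m j).
Proof.
move=> m_gt0; apply: (@polygrowth_sum_ord true 1 (fun i => i * m + j.+1)).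
have gm : polygrowth true 1 (fun d => d * m).
  have := polygrowthM polygrowth_id (polygrowth_const m).
  by rewrite -lt0n m_gt0.
have := polygrowthD gm (polygrowth_weaken (t := false) (M := 1) _ _ (polygrowth_const j.+1)).
exact.
Qed.

Lemma polygrowth_column m n (S : {set 'I_n}) j (al be : nat) : 0 < m ->
  polygrowth ((j \in S) || (al == 0) && (be == 0)) (2 * al + be + (j \in S))
    (fun d => \sum_(c : 'I_d.+2 | allowed S j c) col_sigma m j c ^ al * c ^ be).
Proof.
move=> m_gt0; pose w c := col_sigma m j c ^ al * c ^ be.
have gw : polygrowth true (2 * al + be) w.
  apply: polygrowthM (polygrowthX al (polygrowth_col_sigma j m_gt0)) _.
  by have := polygrowthX be polygrowth_id; rewrite mul1n.
case: (boolP (j \in S)) => jS; last first.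
  (* Outside the support only height 0 is allowed; the factor is the constant [w 0], equal to 1 when
     both exponents vanish because [0 ^ 0 = 1]. *)
  apply: polygrowth_weaken (leq0n _) _ (eq_polygrowth _ (polygrowth_const (w 0))).
    by rewrite /w /= => /andP[/eqP-> /eqP->]; rewrite !expn0.
  move=> d; rewrite (big_pred1 ord0) // => c.
  rewrite /allowed (negbTE jS) eqbF_neg negbK /= -[c == _]val_eqE /=.
  by case: (val c).
have gs := polygrowth_sum_ord (polygrowthS gw).
rewrite addn1 /=.
(* Total height is [d.+1]: nonzero heights run over 1 to [d] in the last column, where the corner is
   excluded, and over 1 to [d.+1] elsewhere, hence one more shift there. *)
have [jn|jn] := eqVneq j.+1 n.
  apply: eq_polygrowth gs => d.
  rewrite [RHS]big_mkcond big_ord_recl big_ord_recr /= /allowed jS jn /= !eqxx.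
  rewrite add0n addn0; apply: eq_bigr => i _.
  by rewrite /bump add1n eqSS ltn_eqF.
apply: eq_polygrowth (polygrowthS gs) => d.
rewrite [RHS]big_mkcond big_ord_recl /= /allowed jS (negbTE jn) add0n.
by apply: eq_bigr => i _; rewrite andbF.
Qed.

(** * The largest separated supports *)

Lemma card_separated n (S : {set 'I_n}) : separated S -> #|S| <= uphalf n.
Proof.
move=> /forallP sep.
have half_lt (j : 'I_n) : j./2 < uphalf n by have := ltn_ord j; lia.
rewrite -[uphalf n]card_ord.
(* Pigeonhole: distinct columns with equal halves are adjacent, so halving is injective on [S]. *)
apply: (@leq_card_in _ _ (fun j => Ordinal (half_lt j))) => j j' Sj Sj' [eq_half].
apply: val_inj; wlog lt_jj' : j j' Sj Sj' eq_half / j < j'.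
  by move=> W; case: (ltngtP j j') => // lt; [| apply/esym]; apply: W.
have /forallP/(_ j') := sep j; rewrite Sj Sj' andbT implybF.
by move/eqP; lia.
Qed.

Lemma separated_even n : separated [set j : 'I_n | ~~ odd j].
Proof.
apply/forallP=> j; apply/forallP=> j'; rewrite !inE.
by apply/implyP=> /andP[/eqP->] /=; rewrite negbK.
Qed.

Lemma card_even n : #|[set j : 'I_n | ~~ odd j]| = uphalf n.
Proof.
apply/eqP; rewrite eqn_leq card_separated ?separated_even //=.
have double_lt (i : 'I_(uphalf n)) : i.*2 < n by have := ltn_ord i; lia.
pose f i := Ordinal (double_lt i).
have f_inj : injective f by move=> i i' [/double_inj/val_inj].
rewrite -[uphalf n]card_ord -(card_imset _ f_inj); apply/subset_leq_card/subsetP.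
by move=> _ /imsetP[i _ ->]; rewrite inE /= odd_double.
Qed.

Lemma sum_fibers (I J : finType) (f : I -> J) : \sum_j #|[pred t | f t == j]| = #|I|.
Proof.
rewrite -sum1_card (partition_big f xpredT) //=.
by apply: eq_bigr => j _; rewrite sum1_card.
Qed.

(** * The degree of the whole sum *)

Lemma polygrowth_Gminus m n a b : 0 < m -> 0 < n ->
  polygrowth true (2 * a + b + uphalf n) (fun d => Gminus d.+1 m a b n).
Proof.
move=> m_gt0 n_gt0; pose fiber k (f : {ffun 'I_k -> 'I_n}) (j : 'I_n) := #|[pred t | f t == j]|.
(* The terms certified to reach the full degree: [S] has maximal size and no factor of either power
   falls on a column outside [S]. *)
pose top (S : {set 'I_n}) (fg : {ffun 'I_a -> 'I_n} * {ffun 'I_b -> 'I_n}) :=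
  [forall j : 'I_n, (j \in S) || (fiber a fg.1 j == 0) && (fiber b fg.2 j == 0)]
  && (#|S| == uphalf n).
apply: eq_polygrowth (fun d => esym (Gminus_expand d m a b n)) _.
have top_even : [exists (S : {set 'I_n} | separated S), [exists (fg | true), top S fg]].
  apply/existsP; exists [set j : 'I_n | ~~ odd j]; rewrite separated_even /=.
  (* Sending every factor to column 0, which is even, leaves the odd columns with empty fibres. *)
  apply/existsP; exists ([ffun=> Ordinal n_gt0], [ffun=> Ordinal n_gt0]).
  rewrite /= /top card_even eqxx andbT; apply/forallP=> j; rewrite inE -implybE.
  apply/implyP=> odd_j; have j_neq0 : (Ordinal n_gt0 == j) = false.
    by apply/negbTE/eqP=> Dj; rewrite -Dj in odd_j.
  by rewrite /fiber !eq_card0 // => t; rewrite !inE ffunE j_neq0.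
rewrite -[X in polygrowth X]top_even; apply: polygrowth_sum => S sepS.
apply: polygrowth_sum => fg _.
have deg : \sum_(j < n) (2 * fiber a fg.1 j + fiber b fg.2 j + (j \in S)) = 2 * a + b + #|S|.
  by rewrite 2!big_split /= -big_distrr /= !sum_fibers !card_ord -big_mkcond sum1_card.
apply: polygrowth_weaken (polygrowth_prod (fun j : 'I_n =>
  polygrowth_column S j (fiber a fg.1 j) (fiber b fg.2 j) m_gt0)).
  by rewrite deg leq_add2l card_separated.
by case/andP=> -> /eqP cardS; rewrite deg cardS /=.
Qed.

Local Open Scope ring_scope.

Theorem theorem4p7 (m n a b : nat) (hm : (1 <= m)%N) (hn : (1 <= n)%N) :
  exists p : {poly rat},
    size p = (2 * a + b + (n + 1) %/ 2).+1%N
    /\ forall d : nat, (1 <= d)%N -> (Gminus d m a b n)%:R = p.[d%:R].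
Proof.
have [p [szp _ /= p_top Dp]] := polygrowth_Gminus a b hm hn.
rewrite addn1 divn2 -uphalfE.
(* [p] gives the value at [d.+1], so it is shifted back by one; this preserves the size, which is
   exact because the top coefficient is nonzero. *)
exists (p \Po ('X + (-1)%:P)); split.
  rewrite size_comp_poly2 ?size_XaddC //; apply/eqP; rewrite eqn_leq szp ltnNge.
  by apply: contra p_top => sz; rewrite nth_default.
case=> // d _; rewrite Dp horner_comp !hornerE.
by rewrite -natr1 addrK.
Qed.
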